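(* Consider the nearest-neighbor continuous-time quantum walk on $\mathbb{Z}^2$ started from the origin, with transition amplitudes $\psi_{(i,j)}(t)$ from $(0,0)$ to $(i,j)$, and let $\psi_i(t)$ be the transition amplitude from $0$ to $i$ of the nearest-neighbor continuous-time quantum walk on $\mathbb{Z}$ started from the origin. Then for all $i,j\in\mathbb{Z}$ and all $t\in\mathbb{R}$, $$\psi_{(i,j)}(t)=\psi_i(t)\,\psi_j(t).$$
   Context: For $d\in\{1,2\}$ let $X$ be the adjacency operator of the graph $\mathbb{Z}^d$ (vertices at Euclidean distance $1$ are adjacent), a bounded self-adjoint operator on $L^2(\mathbb{Z}^d)=\ell^2(\mathbb{Z}^d)$, and let $\delta_v$ be the delta function at the vertex $v$. The nearest-neighbor quantum walk has evolution $U_t=\exp(itX)$. The amplitudes are $\psi_{(i,j)}(t)=\langle\delta_{(i,j)},U_t\delta_{(0,0)}\rangle$ for $d=2$ and $\psi_i(t)=\langle\delta_i,U_t\delta_0\rangle$ for $d=1$. *)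

(* Defs.v *)
From HB Require Import structures.
From mathcomp Require Import all_boot all_order all_algebra complex finmap ring.
From mathcomp Require Import all_classical all_reals all_analysis.
From mathcomp Require summability.

Set Implicit Arguments.
Unset Strict Implicit.
Unset Printing Implicit Defensive.
Import Order.TTheory GRing.Theory Num.Theory numFieldNormedType.Exports.
Local Open Scope classical_set_scope.
Local Open Scope ring_scope.

Notation normc := ComplexField.Normc.normc.

Section l2.
Variables (R : realType) (V : choiceType).

Definition sqsum (f : V -> R[i]) : \bar R := (\esum_(v in [set: V]) ((normc (f v)) ^+ 2)%:E)%E.

Definition is_l2 : pred (V -> R[i]) := fun f => `[< (sqsum f < +oo)%E >].

Lemma sqsum_ge0 f : (0 <= sqsum f)%E.
Proof. by apply: esum_ge0 => v _; rewrite lee_fin sqr_ge0. Qed.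

Lemma is_l2P f : is_l2 f -> sqsum f = (fine (sqsum f))%:E.
Proof. by move=> /asboolP h; rewrite fineK// ge0_fin_numE// sqsum_ge0. Qed.

Lemma normc_nneg (z : R[i]) : 0 <= normc z.
Proof. by case: z => a b; rewrite sqrtr_ge0. Qed.

Lemma sqsum_lin (f g h : V -> R[i]) (l m : R) : 0 <= l -> 0 <= m ->
  (forall v, normc (h v) ^+ 2 <= l * normc (f v) ^+ 2 + m * normc (g v) ^+ 2) ->
  (sqsum h <= l%:E * sqsum f + m%:E * sqsum g)%E.
Proof.
move=> l0 m0 H.
apply: ge_ereal_sup => _ [F [finF _] <-].
apply: (@le_trans _ _ (\sum_(v \in F) ((l * normc (f v) ^+ 2)%:E +
                                       (m * normc (g v) ^+ 2)%:E)))%E.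
  by apply: lee_fsum => // v Fv; rewrite -EFinD lee_fin.
rewrite fsbig_split//=; apply: leeD.
  under eq_fsbigr do rewrite EFinM.
  rewrite -ge0_mule_fsumr; last by move=> v; rewrite lee_fin sqr_ge0.
  by rewrite lee_wpmul2l ?lee_fin//; apply: ereal_sup_ubound; exists F.
under eq_fsbigr do rewrite EFinM.
rewrite -ge0_mule_fsumr; last by move=> v; rewrite lee_fin sqr_ge0.
by rewrite lee_wpmul2l ?lee_fin//; apply: ereal_sup_ubound; exists F.
Qed.

Lemma normcD_sqr (x y : R[i]) (a b : R) : 0 < a -> 0 < b ->
  normc (x + y) ^+ 2 <= (1 + b / a) * normc x ^+ 2 + (1 + a / b) * normc y ^+ 2.
Proof.
move=> a0 b0.
have h : normc (x + y) <= normc x + normc y by exact: le_normcD.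
have {h} : normc (x + y) ^+ 2 <= (normc x + normc y) ^+ 2.
  by rewrite ler_pXn2r// nnegrE ?addr_ge0// normc_nneg.
move=> /le_trans; apply.
set p := normc x; set q := normc y.
rewrite -subr_ge0.
suff -> : (1 + b / a) * p ^+ 2 + (1 + a / b) * q ^+ 2 - (p + q) ^+ 2 =
  (b * p - a * q) ^+ 2 / (a * b).
  by rewrite divr_ge0 ?sqr_ge0// mulr_ge0// ltW.
by field; rewrite ?gt_eqF.
Qed.

Lemma is_l2_submod : submod_closed is_l2.
Proof.
have l20 : sqsum (0 : V -> R[i]) = 0%E.
  by apply: esum1 => v _; rewrite (_ : (0 : V -> R[i]) v = 0)// ComplexField.Normc.normc0 expr0n.
split; first by apply/asboolP; rewrite l20.
move=> z f g; rewrite !unfold_in => fl gl; apply/asboolP.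
have ef := is_l2P fl; have eg := is_l2P gl.
apply: (@le_lt_trans _ _
  ((2 * normc z ^+ 2)%:E * sqsum f + 2%:E * sqsum g)%E).
  apply: sqsum_lin => // [|v]; first by rewrite mulr_ge0// sqr_ge0.
  have := @normcD_sqr (z * f v) (g v) 1 1 ltr01 ltr01.
  by rewrite divr1 ComplexField.Normc.normcM exprMn mulrA.
by rewrite ef eg -!EFinM -EFinD ltry.
Qed.

HB.instance Definition _ := GRing.isSubmodClosed.Build _ _ is_l2 is_l2_submod.

Record l2 := L2 { l2_fun :> V -> R[i] ; _ : l2_fun \in is_l2 }.

HB.instance Definition _ := [isSub for l2_fun].
HB.instance Definition _ := [Choice of l2 by <:].
HB.instance Definition _ := [SubChoice_isSubLmodule of l2 by <:].

Definition l2_rnorm (f : l2) : R := Num.sqrt (fine (sqsum f)).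

Lemma l2_sqsumE (f : l2) : sqsum f = (l2_rnorm f ^+ 2)%:E.
Proof.
rewrite sqr_sqrtr ?fine_ge0 ?sqsum_ge0//.
by apply: is_l2P; case: f.
Qed.

Lemma l2_rnorm_ge0 (f : l2) : 0 <= l2_rnorm f. Proof. exact: sqrtr_ge0. Qed.

Lemma sqsum_le_rnorm (f : l2) (a : R) : 0 <= a -> (sqsum f <= (a ^+ 2)%:E)%E ->
  l2_rnorm f <= a.
Proof. by move=> a0; rewrite l2_sqsumE lee_fin ler_pXn2r ?nnegrE ?sqrtr_ge0. Qed.

Lemma l2_rnormP (f : l2) v : normc (f v) <= l2_rnorm f.
Proof.
have : (((normc (f v)) ^+ 2)%:E <= sqsum f)%E.
  apply: ereal_sup_ubound; exists [set v].
    by split => //; exact: finite_set1.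
  by rewrite fsbig_set1.
by rewrite l2_sqsumE lee_fin ler_pXn2r ?nnegrE ?sqrtr_ge0// normc_nneg.
Qed.

Lemma l2_rnorm_eq0 (f : l2) : l2_rnorm f = 0 -> f = 0.
Proof.
move=> f0; apply/val_inj/funext => v; apply: ComplexField.Normc.eq0_normc.
by apply/eqP; rewrite eq_le normc_nneg -f0 l2_rnormP.
Qed.

Lemma l2_rnormD (f g : l2) : l2_rnorm (f + g) <= l2_rnorm f + l2_rnorm g.
Proof.
have [f0|f0] := eqVneq (l2_rnorm f) 0.
  by rewrite f0 (l2_rnorm_eq0 f0) !add0r.
have [g0|g0] := eqVneq (l2_rnorm g) 0.
  by rewrite g0 (l2_rnorm_eq0 g0) !addr0.
have {}f0 : 0 < l2_rnorm f by rewrite lt_def f0 sqrtr_ge0.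
have {}g0 : 0 < l2_rnorm g by rewrite lt_def g0 sqrtr_ge0.
apply: sqsum_le_rnorm; first by rewrite addr_ge0// ltW.
apply: (le_trans (sqsum_lin _ _ (fun v => normcD_sqr _ _ f0 g0))).
- by rewrite addr_ge0// divr_ge0// ltW.
- by rewrite addr_ge0// divr_ge0// ltW.
rewrite !l2_sqsumE -!EFinM -EFinD lee_fin le_eqVlt; apply/orP; left; apply/eqP.
by field; rewrite ?gt_eqF.
Qed.

Lemma l2_rnormZ_le (z : R[i]) (f : l2) : l2_rnorm (z *: f) <= normc z * l2_rnorm f.
Proof.
apply: sqsum_le_rnorm; first by rewrite mulr_ge0 ?normc_nneg ?sqrtr_ge0.
apply: (@le_trans _ _ (((normc z) ^+ 2)%:E * sqsum f + 0%:E * sqsum f)%E).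
  apply: sqsum_lin => //; rewrite ?sqr_ge0// => v.
  by rewrite ComplexField.Normc.normcM exprMn mul0r addr0.
by rewrite mul0e adde0 l2_sqsumE -EFinM -exprMn.
Qed.

Lemma l2_rnormZ (z : R[i]) (f : l2) : l2_rnorm (z *: f) = normc z * l2_rnorm f.
Proof.
have [->|z0] := eqVneq z 0.
  rewrite ComplexField.Normc.normc0 mul0r; apply/eqP.
  rewrite eq_le l2_rnorm_ge0 andbT.
  by rewrite (le_trans (l2_rnormZ_le _ _))// ComplexField.Normc.normc0 mul0r.
apply/eqP; rewrite eq_le l2_rnormZ_le/=.
rewrite -{1}[f](scalerK z0).
rewrite (le_trans (ler_wpM2l (normc_nneg _) (l2_rnormZ_le _ _)))//.
by rewrite mulrA -ComplexField.Normc.normcM divff// ComplexField.Normc.normc1 mul1r.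
Qed.

(* The scalars are [R[i]], so library norms take values in [R[i]]. *)
Definition l2_norm (f : l2) : R[i] := ((l2_rnorm f)%:C)%C.

Let l2_normD (f g : l2) : l2_norm (f + g) <= l2_norm f + l2_norm g.
Proof. by rewrite -rmorphD lecR l2_rnormD. Qed.

Let l2_normZ z (f : l2) : l2_norm (z *: f) = `|z| * l2_norm f.
Proof. by rewrite /l2_norm l2_rnormZ rmorphM. Qed.

Let l2_norm_eq0 (f : l2) : l2_norm f = 0 -> f = 0.
Proof. by move=> [/l2_rnorm_eq0]. Qed.

HB.instance Definition _ :=
  Lmodule_isNormed.Build R[i] l2 l2_normD l2_normZ l2_norm_eq0.

(* Conjugate-linear in the first argument; [summability.sum] is the limit of
   the finite partial sums along the filter of finite subsets of [V]. *)
Definition l2_inner (f g : l2) : R[i] :=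
  summability.sum (fun v => (f v)^*%C * g v : R[i]^o).

Lemma l2_normE (f : l2) : `|f| = ((l2_rnorm f)%:C)%C. Proof. by []. Qed.

Definition delta_fun (v : V) : V -> R[i] := fun w => (w == v)%:R.

Lemma sqsum_delta v : sqsum (delta_fun v) = 1%E.
Proof.
transitivity (\esum_(w in [set v]) (1%E : \bar R))%E; last first.
  by rewrite esum_set1.
rewrite [RHS]esum_mkcond; apply: eq_esum => w _.
rewrite /delta_fun; case: ifPn => [/set_mem/= ->|/negP wv].
  by rewrite eqxx ComplexField.Normc.normc1 expr1n.
case: eqP => [e|_]; first by case: wv; rewrite inE.
by rewrite ComplexField.Normc.normc0 expr0n.
Qed.

Lemma delta_subproof v : delta_fun v \in is_l2.
Proof. by apply/asboolP; rewrite sqsum_delta ltry. Qed.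

Definition delta v : l2 := L2 (delta_subproof v).

Lemma l2_inner_delta (v : V) (f : l2) :
  l2_inner (delta v) f = f v.
Proof.
rewrite /l2_inner /summability.sum; have TF := @summability.totally_filter V.
apply: (@cvg_lim R[i]^o (@norm_hausdorff _ R[i]^o) _ _ TF).
apply: (@cvg_near_cst _ R[i]^o); exists [fset v]%fset => // A /= vA.
have vin : v \in A by apply: (fsubsetP vA); rewrite inE.
rewrite /summability.partial_sum (bigD1 [` vin]%fset)//= big1 ?addr0.
  by rewrite /delta_fun eqxx conjc1 mul1r.
move=> w wv; rewrite /delta_fun (_ : val w == v = false) ?conjc0 ?mul0r//.
by apply: contraNF wv => /eqP e; apply/eqP/val_inj.
Qed.

End l2.
Arguments l2_inner {R V} f g.
Arguments delta R {V} v.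

Section bop.
Variables (R : realType) (H : normedModType R[i]).

Definition op_bound (A : H -> H) : set R :=
  [set M | 0 <= M /\ forall x, `|A x| <= (M%:C)%C * `|x|].

Definition is_bop : pred (H -> H) :=
  fun A => `[< linear A /\ op_bound A !=set0 >].

Lemma op_boundD (A B : H -> H) (z : R[i]) M N : op_bound A M -> op_bound B N ->
  op_bound (z *: A + B) (normc z * M + N).
Proof.
move=> [M0 AM] [N0 BN]; split.
  by rewrite addr_ge0// mulr_ge0// normc_nneg.
move=> x; rewrite [X in `|X|](_ : _ = z *: A x + B x)//.
rewrite (le_trans (ler_normD _ _))// rmorphD mulrDl lerD// normrZ rmorphM -mulrA.
by rewrite ler_wpM2l.
Qed.

Lemma is_bop_submod : submod_closed is_bop.
Proof.
split.
  apply/asboolP; split; first by move=> z x y; rewrite scaler0 addr0.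
  by exists 0; split => // x; rewrite normr0 rmorph0 mul0r.
move=> z A B /asboolP[lA [M AM]] /asboolP[lB [N BN]]; apply/asboolP; split.
  move=> a x y.
  rewrite -[LHS]/(z *: A (a *: x + y) + B (a *: x + y)).
  rewrite -[RHS]/(a *: (z *: A x + B x) + (z *: A y + B y)).
  by rewrite lA lB !scalerDr !scalerA [z * a]mulrC addrACA.
by exists (normc z * M + N); exact: op_boundD.
Qed.

HB.instance Definition _ := GRing.isSubmodClosed.Build _ _ is_bop is_bop_submod.

Record bop := BOp { bop_fun :> H -> H ; _ : bop_fun \in is_bop }.

HB.instance Definition _ := [isSub for bop_fun].
HB.instance Definition _ := [Choice of bop by <:].
HB.instance Definition _ := [SubChoice_isSubLmodule of bop by <:].

Lemma bop_linear (A : bop) : linear A.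
Proof. by case: A => A /= /asboolP[]. Qed.

Lemma bop_bounded (A : bop) : op_bound A !=set0.
Proof. by case: A => A /= /asboolP[]. Qed.

Definition op_rnorm (A : bop) : R := inf (op_bound A).

Lemma op_rnorm_ge0 (A : bop) : 0 <= op_rnorm A.
Proof.
by apply: lb_le_inf => [|M []//]; exact: bop_bounded.
Qed.

Lemma normr_rnorm (x : H) : `|x| = ((normc `|x|)%:C)%C.
Proof. by rewrite -[RHS]/(`|(`|x|)|) normr_id. Qed.

Lemma op_rnormP (A : bop) : op_bound A (op_rnorm A).
Proof.
split; first exact: op_rnorm_ge0.
move=> x; have [->|x0] := eqVneq x 0.
  have -> : A 0 = 0.
    have := bop_linear A 1 0 0; rewrite !scale1r addr0.
    by move/(congr1 (fun y => y - A 0)); rewrite subrr addrK => /esym.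
  by rewrite !normr0 mulr0.
have nx : 0 < normc `|x|.
  by rewrite -ltcR -normr_rnorm normr_gt0.
rewrite (normr_rnorm (A x)) [X in _ * X]normr_rnorm -rmorphM lecR -ler_pdivrMr//.
apply: lb_le_inf => [|M [M0 AM]]; first exact: bop_bounded.
rewrite ler_pdivrMr//.
by move: (AM x); rewrite (normr_rnorm (A x)) [X in _ * X]normr_rnorm -rmorphM lecR -normr_rnorm.
Qed.

Lemma op_rnorm_le (A : bop) M : op_bound A M -> op_rnorm A <= M.
Proof. by move=> AM; apply: ge_inf => //; exists 0 => ? []. Qed.

Lemma op_rnorm_eq0 (A : bop) : op_rnorm A = 0 -> A = 0.
Proof.
move=> A0; apply/val_inj/funext => x.
have [_ /(_ x)] := op_rnormP A.
by rewrite A0 mul0r normr_le0 => /eqP.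
Qed.

Lemma op_rnormD (A B : bop) : op_rnorm (A + B) <= op_rnorm A + op_rnorm B.
Proof.
apply: op_rnorm_le; have := op_boundD 1 (op_rnormP A) (op_rnormP B).
by rewrite scale1r ComplexField.Normc.normc1 mul1r.
Qed.

Lemma op_rnormZ_le z (A : bop) : op_rnorm (z *: A) <= normc z * op_rnorm A.
Proof.
apply: op_rnorm_le; have := op_boundD z (op_rnormP A) (op_rnormP 0).
rewrite addr0 (_ : op_rnorm 0 = 0) ?addr0//.
apply/eqP; rewrite eq_le op_rnorm_ge0 andbT; apply: op_rnorm_le.
by split => // x; rewrite normr0 rmorph0 mul0r.
Qed.

Lemma op_rnormZ z (A : bop) : op_rnorm (z *: A) = normc z * op_rnorm A.
Proof.
have [->|z0] := eqVneq z 0.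
  rewrite ComplexField.Normc.normc0 mul0r; apply/eqP.
  rewrite eq_le op_rnorm_ge0 andbT.
  by rewrite (le_trans (op_rnormZ_le _ _))// ComplexField.Normc.normc0 mul0r.
apply/eqP; rewrite eq_le op_rnormZ_le/=.
rewrite -{1}[A](scalerK z0).
rewrite (le_trans (ler_wpM2l (normc_nneg _) (op_rnormZ_le _ _)))//.
by rewrite mulrA -ComplexField.Normc.normcM divff// ComplexField.Normc.normc1 mul1r.
Qed.

Definition op_norm (A : bop) : R[i] := ((op_rnorm A)%:C)%C.

Let op_normD (A B : bop) : op_norm (A + B) <= op_norm A + op_norm B.
Proof. by rewrite -rmorphD lecR op_rnormD. Qed.

Let op_normZ z (A : bop) : op_norm (z *: A) = `|z| * op_norm A.
Proof. by rewrite /op_norm op_rnormZ rmorphM. Qed.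

Let op_norm_eq0 (A : bop) : op_norm A = 0 -> A = 0.
Proof. by move=> [/op_rnorm_eq0]. Qed.

HB.instance Definition _ :=
  Lmodule_isNormed.Build R[i] bop op_normD op_normZ op_norm_eq0.

Lemma bop_id_subproof : id \in is_bop.
Proof.
apply/asboolP; split => //.
by exists 1; split => // x; rewrite mul1r.
Qed.

Definition bop_id : bop := BOp bop_id_subproof.

Lemma bop_comp_subproof (A B : bop) : A \o B \in is_bop.
Proof.
apply/asboolP; split; first by move=> z x y /=; rewrite !bop_linear.
have [A0 AM] := op_rnormP A; have [B0 BM] := op_rnormP B.
exists (op_rnorm A * op_rnorm B); split; first by rewrite mulr_ge0.
move=> x /=; rewrite (le_trans (AM _))// rmorphM -mulrA ler_wpM2l//.
by rewrite lecR.
Qed.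

Definition bop_comp (A B : bop) : bop := BOp (bop_comp_subproof A B).

Definition bop_pow (A : bop) (k : nat) : bop := iter k (bop_comp A) bop_id.

(* [limn] is taken in the topology of [bop], i.e. in operator norm. *)
Definition bop_exp (A : bop) : bop :=
  limn (series (fun k => (k`!%:R)^-1 *: bop_pow A k)).

End bop.

Section lattice.
Variables (R : realType) (d : nat).
Local Notation V := 'rV[int]_d.

Definition edist (v w : V) : R := Num.sqrt (\sum_(k < d) (v 0 k - w 0 k)%:~R ^+ 2).

Definition neighbours (v : V) : set V := [set w | edist v w = 1].

(* [neighbours v] is finite ([neighboursE]), so this is an ordinary finite sum. *)
Definition adjacency (f : V -> R[i]) : V -> R[i] :=
  fun v => \sum_(w \in neighbours v) f w.

Definition unit_step (s : 'I_d * bool) : V := (-1) ^+ s.2 *: delta_mx 0 s.1.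

Lemma unit_stepE s k : unit_step s 0 k = (-1) ^+ s.2 * (k == s.1)%:R.
Proof. by rewrite !mxE eqxx. Qed.

Lemma unit_step_inj : injective unit_step.
Proof.
move=> [k b] [l c] /(congr1 (fun u : V => u 0 k)).
rewrite !unit_stepE/= eqxx mulr1.
case: eqVneq => [->|_]; first by case: b; case: c.
by rewrite mulr0; case: b.
Qed.

Lemma edistE v w : edist v w = 1 <-> \sum_(k < d) (w 0 k - v 0 k) ^+ 2 = 1 :> int.
Proof.
have -> : edist v w = Num.sqrt ((\sum_(k < d) (w 0 k - v 0 k) ^+ 2)%:~R).
  rewrite /edist rmorph_sum; congr Num.sqrt; apply: eq_bigr => k _.
  by rewrite rmorphXn/= -[in LHS]opprB rmorphN sqrrN.
split=> [h|->]; last by rewrite sqrtr1.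
apply/eqP; rewrite -(eqr_int R); apply/eqP.
have h0 : 0 <= (\sum_(k < d) (w 0 k - v 0 k) ^+ 2)%:~R :> R.
  by rewrite ler0z sumr_ge0// => k _; rewrite sqr_ge0.
by rewrite -[LHS]sqr_sqrtr// h expr1n.
Qed.

Lemma sum_sqr_eq1 (u : V) :
  \sum_(k < d) u 0 k ^+ 2 = 1 -> exists s, u = unit_step s.
Proof.
move=> u1.
have [k uk] : exists k, u 0 k != 0.
  apply: contrapT => /forallNP h; move: u1; rewrite big1// => k _.
  by have /negP/negPn/eqP -> := h k; rewrite expr0n.
have uk1 : 1 <= u 0 k ^+ 2.
  by rewrite -gtz0_ge1 lt_def sqrf_eq0 uk sqr_ge0.
move: u1; rewrite (bigD1 k)//= => u1.
have r0 : \sum_(l < d | l != k) u 0 l ^+ 2 = 0.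
  apply/eqP; rewrite eq_le sumr_ge0 ?andbT; last by move=> *; rewrite sqr_ge0.
  by rewrite -(lerD2l (u 0 k ^+ 2)) u1 addr0.
have rl l : l != k -> u 0 l = 0.
  move=> lk; apply/eqP; rewrite -sqrf_eq0; apply/eqP.
  by apply: (psumr_eq0P _ r0) => // m _; rewrite sqr_ge0.
move: u1; rewrite r0 addr0 => /eqP; rewrite sqrf_eq1 => uk2.
have [b ub] : exists b : bool, u 0 k = (-1) ^+ b.
  by case/orP: uk2 => /eqP ->; [exists false|exists true].
exists (k, b); apply/rowP => l; rewrite unit_stepE/=.
by case: eqVneq => [->|/rl ->]; rewrite ?mulr1 ?mulr0.
Qed.

Lemma neighboursE v : neighbours v = [set v + unit_step s | s in [set: 'I_d * bool]].
Proof.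
apply/seteqP; split => w /=.
  move/edistE => h; have [|s e] := @sum_sqr_eq1 (w - v).
    by rewrite -[RHS]h; apply: eq_bigr => k _; rewrite !mxE.
  by exists s => //; rewrite -e addrC subrK.
move=> [[k b] _ <-]; apply/edistE; rewrite (bigD1 k)//= big1 ?addr0.
  by rewrite mxE unit_stepE/= eqxx mulr1 addrAC subrr add0r sqrr_sign.
move=> l lk; rewrite mxE unit_stepE/= (negbTE lk) mulr0 addr0 subrr.
by rewrite expr0n.
Qed.

Lemma adjacencyE f v : adjacency f v = \sum_s f (v + unit_step s).
Proof.
rewrite /adjacency neighboursE fsbig_image; last first.
  by move=> s s' _ _ /addrI/unit_step_inj.
rewrite [RHS](fsbig_seq _ _ (index_enum_uniq _)); congr (\big[_/_]_(s \in _) _).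
by apply/seteqP; split => // s _ /=; rewrite mem_index_enum.
Qed.

Lemma sqsum_shift (u : V) (f : V -> R[i]) :
  sqsum (fun v => f (v + u)) = sqsum f.
Proof.
rewrite /sqsum; apply/esym; apply: (reindex_esum setT setT (+%R^~ u)).
split => //; first by move=> v w _ _ /addIr.
by move=> w _; exists (w - u) => //; rewrite subrK.
Qed.

Lemma shift_subproof (u : V) (f : l2 R V) : (fun v => f (v + u)) \in @is_l2 R V.
Proof. by apply/asboolP; rewrite sqsum_shift; case: f => f /= /asboolP. Qed.

Definition l2_shift (u : V) (f : l2 R V) : l2 R V := L2 (shift_subproof u f).

Lemma l2_shift_bop u : l2_shift u \in @is_bop R (l2 R V).
Proof.
apply/asboolP; split; first by move=> z f g; exact/val_inj/funext.
exists 1; split => // f.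
by rewrite mul1r !l2_normE lecR/= /l2_rnorm sqsum_shift.
Qed.

Lemma adjacency_sum (f : l2 R V) :
  adjacency f = \val (\sum_s l2_shift (unit_step s) f).
Proof.
by apply/funext => v; rewrite adjacencyE raddf_sum fct_sumE.
Qed.

Lemma adjacency_subproof (f : l2 R V) : adjacency f \in @is_l2 R V.
Proof. rewrite adjacency_sum; exact: valP. Qed.

Definition l2_adjacency (f : l2 R V) : l2 R V := L2 (adjacency_subproof f).

Lemma l2_adjacencyE : l2_adjacency = \sum_s l2_shift (unit_step s).
Proof.
by apply/funext => f; apply: val_inj; rewrite /= adjacency_sum fct_sumE.
Qed.

Lemma l2_adjacency_bop : l2_adjacency \in @is_bop R (l2 R V).
Proof. by rewrite l2_adjacencyE rpred_sum// => s _; exact: l2_shift_bop. Qed.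

Definition adjacency_op : bop (l2 R V) := BOp l2_adjacency_bop.

(* [(0 +i* t)] is the complex number i t. *)
Definition evolution (t : R) : bop (l2 R V) :=
  bop_exp ((0 +i* t)%C *: adjacency_op).

Definition amplitude (v : V) (t : R) : R[i] :=
  l2_inner (delta R v) (evolution t (delta R 0)).

End lattice.

Definition point1 (i : int) : 'rV[int]_1 := const_mx i.

Definition point2 (i j : int) : 'rV[int]_2 := \row_k [:: i; j]`_k.

(* Main.v *)
Require Import Defs.
From mathcomp Require Import all_boot all_order all_algebra complex.
From mathcomp Require Import all_classical all_reals all_analysis.
From mathcomp Require Import ring.

(* The amplitudes at [v] are the sums of the series of the coefficients
   c_k(v) = ((z A)^k delta_0)(v) / k! with z = i t, once the exponential series
   is known to converge in operator norm, i.e. once l^2 is complete.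
   The adjacency operator of Z^2 is the sum of two commuting copies of that of
   Z, so the coefficients on Z^2 are the Cauchy convolutions of those on Z; this
   follows by induction from (k+1) c_(k+1)(v) = z * sum of c_k over the
   neighbours of v.  Finally |c_k| <= M^k / k!, which justifies the Cauchy
   product: the error is dominated by the corresponding error for the real
   exponentials, and that one tends to 0 because exp (x + y) = exp x * exp y. *)

Set Implicit Arguments.
Unset Strict Implicit.
Unset Printing Implicit Defensive.
Import Order.TTheory GRing.Theory Num.Theory numFieldNormedType.Exports.
Local Open Scope classical_set_scope.
Local Open Scope ring_scope.

(** * Convergence in [R[i]], measured by real-valued moduli *)

Section complex_limits.
Variable R : realType.
Local Notation cRe := (@complex.Re R).
Local Notation cIm := (@complex.Im R).

Lemma cvg_rnorm_le (H : normedModType R[i]) (u : nat -> H) (l : H) (r : nat -> R) :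
  (forall n, `|l - u n| <= ((r n)%:C)%C) -> r @ \oo --> (0 : R) -> u @ \oo --> l.
Proof.
move=> ur /cvgrPdist_le r0; apply/cvgrPdist_le => -[a b].
(* A positive element of [R[i]] has zero imaginary part, so epsilon is a positive real [a]. *)
rewrite ltcE /= => /andP[/eqP -> a0].
have [N _ Nr] := r0 _ a0; exists N => // n /Nr; rewrite sub0r normrN => rn.
by apply: (le_trans (ur n)); rewrite lecR (le_trans (ler_norm _)).
Qed.

Lemma cvg_rnorm0 (H : normedModType R[i]) (u : nat -> H) (l : H) (r : nat -> R) :
  (forall n, `|l - u n| = ((r n)%:C)%C) -> u @ \oo --> l -> r @ \oo --> (0 : R).
Proof.
move=> ur /cvgrPdist_le r0; apply/cvgrPdist_le => e e0.
have [|N _ Nr] := r0 (e%:C)%C; first by rewrite ltcR.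
exists N => // n /Nr; rewrite sub0r normrN ur lecR => rn.
rewrite ger0_norm// -lecR -ur; exact: normr_ge0.
Qed.

Lemma normr_complexE (z : R[i]) : `|z| = ((normc z)%:C)%C.
Proof. by []. Qed.

Lemma normcN (w : R[i]) : normc (- w) = normc w.
Proof. by apply: (@complexI R); rewrite -!normr_complexE normrN. Qed.

Lemma normcB_ge (z w : R[i]) : `|normc z - normc w| <= normc (z - w).
Proof.
have leB x y : normc x - normc y <= normc (x - y).
  by rewrite lerBlDr; apply: le_trans (le_normcD _ _); rewrite subrK.
by rewrite ler_norml leB andbT lerNl opprB -[normc (z - w)]normcN opprB leB.
Qed.

Lemma cvg_normcB (u : nat -> R[i]) (l w : R[i]) :
  normc (l - u n) @[n --> \oo] --> (0 : R) ->
  normc (u n - w) @[n --> \oo] --> normc (l - w).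
Proof.
move=> /cvgrPdist_le h; apply/cvgrPdist_le => e /h; apply: filterS => n.
rewrite sub0r normrN; apply: le_trans; rewrite (le_trans (normcB_ge _ _))//.
by rewrite opprB addrA subrK ler_norm.
Qed.

Lemma normc_lim_unique (u : nat -> R[i]) (l l' : R[i]) :
  normc (l - u n) @[n --> \oo] --> (0 : R) ->
  normc (l' - u n) @[n --> \oo] --> (0 : R) -> l = l'.
Proof.
move=> ul ul'; apply/eqP; rewrite -subr_eq0; apply/eqP.
apply: ComplexField.Normc.eq0_normc; apply/eqP.
rewrite eq_le normc_nneg andbT.
have h : normc (l - u n) + normc (l' - u n) @[n --> \oo] --> (0 : R).
  by rewrite -[X in _ --> X]addr0; exact: cvgD.
apply: (cvgr_to_ge h); apply: nearW => n /=.
rewrite -[normc (l' - _)]normcN opprB; apply: le_trans (le_normcD _ _).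
by rewrite addrA subrK.
Qed.

Lemma normc_Re_le (z : R[i]) : `|cRe z| <= normc z.
Proof. by case: z => a b /=; rewrite -sqrtr_sqr ler_wsqrtr// lerDl sqr_ge0. Qed.

Lemma normc_Im_le (z : R[i]) : `|cIm z| <= normc z.
Proof. by case: z => a b /=; rewrite -sqrtr_sqr ler_wsqrtr// lerDr sqr_ge0. Qed.

Lemma normc_le_ReIm (z : R[i]) : normc z <= `|cRe z| + `|cIm z|.
Proof.
case: z => a b /=; rewrite -[leRHS]ger0_norm ?addr_ge0// -sqrtr_sqr ler_wsqrtr//.
by rewrite sqrrD !real_normK ?num_real// lerD2r lerDl mulrn_wge0// mulr_ge0.
Qed.

Lemma complex_series_cvg (u : nat -> R[i]) (v : nat -> R) :
  (forall k, normc (u k) <= v k) -> cvgn (series v) ->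
  exists l : R[i], normc (l - series u n) @[n --> \oo] --> (0 : R).
Proof.
move=> uv cv.
have v0 k : 0 <= v k by exact: le_trans (normc_nneg _) (uv k).
(* Real and imaginary parts are treated alike: both are additive and bounded by the modulus, so [v]
   dominates both real series. *)
have part (f : R[i] -> R) : (forall z, `|f z| <= normc z) -> f 0 = 0 ->
    {morph f : x y / x + y} -> cvgn (f \o series u).
  move=> fn f0 fD; rewrite (_ : f \o series u = series (f \o u)).
    apply: normed_cvg; apply: series_le_cvg cv => // k /=; first exact: normr_ge0.
    exact: le_trans (fn _) (uv k).
  by apply/funext => n /=; rewrite /series/= (big_morph f fD f0).
have reC : cvgn (cRe \o series u).
  by apply: part => //; [exact: normc_Re_le|case=> ? ? []].
have imC : cvgn (cIm \o series u).
  by apply: part => //; [exact: normc_Im_le|case=> ? ? []].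
set a := limn (cRe \o series u); set b := limn (cIm \o series u).
exists (a +i* b)%C.
have dist0 (w : nat -> R) : cvgn w -> `|limn w - w n| @[n --> \oo] --> (0 : R).
  move=> cw; apply/norm_cvg0P; rewrite -[X in _ --> X](subrr (limn w)).
  by apply: cvgB => //; exact: cvg_cst.
apply: (@squeeze_cvgr _ _ _ _ (fun=> 0) (fun n => `|a - cRe (series u n)| +
    `|b - cIm (series u n)|)); last 2 first.
- exact: cvg_cst.
- by rewrite -[X in _ --> X]addr0; apply: cvgD; exact: dist0.
apply: nearW => n; rewrite normc_nneg /=.
by rewrite (le_trans (normc_le_ReIm _))//; case: (series u n).
Qed.
End complex_limits.

(** * Completeness: dominated series in l^2 and in the space of bounded operators *)

Section l2_operators.
Variable R : realType.

Lemma l2_subE (V : choiceType) (f g : l2 R V) v : (f - g) v = f v - g v.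
Proof. by []. Qed.

Lemma l2_scaleE (V : choiceType) z (f : l2 R V) v : (z *: f) v = z * f v.
Proof. by []. Qed.

Lemma l2_sumE (V : choiceType) (I : Type) (r : seq I) (f : I -> l2 R V) v :
  (\sum_(k <- r) f k) v = \sum_(k <- r) f k v.
Proof. by rewrite -[LHS]/((\val (\sum_(k <- r) f k)) v) raddf_sum fct_sumE. Qed.

Lemma bop_subE (H : normedModType R[i]) (A B : bop H) x : (A - B) x = A x - B x.
Proof. by []. Qed.

Lemma bop_scaleE (H : normedModType R[i]) z (A : bop H) x : (z *: A) x = z *: A x.
Proof. by []. Qed.

Lemma bop_sumE (H : normedModType R[i]) (I : Type) (r : seq I)
  (T : I -> bop H) x : (\sum_(k <- r) T k) x = \sum_(k <- r) T k x.
Proof. by rewrite -[LHS]/((\val (\sum_(k <- r) T k)) x) raddf_sum fct_sumE. Qed.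

Lemma l2_rnorm_sum (V : choiceType) (I : Type) (r : seq I) (T : I -> l2 R V)
    (e : I -> R) :
  (forall k, l2_rnorm (T k) <= e k) ->
  l2_rnorm (\sum_(k <- r) T k) <= \sum_(k <- r) e k.
Proof.
move=> Te; elim/big_ind2 : _ => //.
  by rewrite -lecR -l2_normE normr0.
by move=> x1 x2 y1 y2 h1 h2; rewrite (le_trans (l2_rnormD _ _))// lerD.
Qed.

Lemma sum_le_l2_rnorm (V : choiceType) (f : l2 R V) (F : set V) : finite_set F ->
  \sum_(v \in F) normc (f v) ^+ 2 <= l2_rnorm f ^+ 2.
Proof.
move=> finF; rewrite -lee_fin -l2_sqsumE -fsumEFin//.
by apply: ereal_sup_ubound; exists F.
Qed.

(** The sum is built pointwise, each coordinate being dominated by [e]. The explicit rate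
    [s - series e n] is what later makes convergence uniform on operators. *)
Lemma l2_series_cvg (V : choiceType) (T : nat -> l2 R V) (e : nat -> R) (s : R) :
  (forall k, l2_rnorm (T k) <= e k) -> series e @ \oo --> s ->
  exists f : l2 R V, forall n, l2_rnorm (f - series T n) <= s - series e n.
Proof.
move=> Te es; have ce : cvgn (series e) by apply/cvg_ex; exists s.
have sE : limn (series e) = s by exact: cvg_lim.
have e0 k : 0 <= e k by exact: le_trans (l2_rnorm_ge0 _) (Te k).
have Tv v : exists l : R[i],
      normc (l - series (fun k => T k v) n) @[n --> \oo] --> (0 : R).
  by apply: complex_series_cvg ce => k; apply: le_trans (l2_rnormP _ _) (Te k).
have [l lP] := choice Tv.
have TnE n v : series T n v = series (fun k => T k v) n.
  exact: l2_sumE.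
have ge_e n m : (n <= m)%N -> series e n <= series e m.
  by move=> nm; rewrite -subr_ge0 sub_series_geq// sumr_ge0.
have le_lim n : series e n <= s.
  by rewrite -sE; apply: nondecreasing_cvgn_le => // i j; exact: ge_e.
(* Fatou-type argument: over a finite [F], bound the tail between [n] and [m], let [m] tend to
   infinity, then take the supremum over [F]. *)
have Dn n : (sqsum (fun v => (l v - series T n v)%R) <=
    ((s - series e n)%R ^+ 2)%:E)%E.
  apply: ge_ereal_sup => _ [F [finF _] <-].
  rewrite fsumEFin// lee_fin.
  have cv : (\sum_(v \in F) normc ((series T m - series T n) v) ^+ 2) @[m --> \oo]
      --> \sum_(v \in F) normc (l v - series T n v) ^+ 2.
    rewrite fsbig_finite//=; under eq_cvg do rewrite fsbig_finite//=.
    apply: cvg_big => [|v _]; first exact: add_continuous.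
    have nv : normc ((series T m - series T n) v) @[m --> \oo]
        --> normc (l v - series T n v).
      apply: (@cvg_normcB R (fun m => series T m v)).
      by under eq_cvg do rewrite TnE; exact: lP.
    by rewrite expr2; under eq_cvg do rewrite expr2; exact: cvgM.
  apply: (cvgr_to_le cv); exists n => // m /= nm.
  apply: (le_trans (sum_le_l2_rnorm (series T m - series T n) finF)).
  rewrite ler_pXn2r ?nnegrE ?l2_rnorm_ge0 ?subr_ge0//.
  apply: (@le_trans _ _ (series e m - series e n)); last by rewrite lerD2r.
  by rewrite !sub_series_geq//; apply: l2_rnorm_sum.
have l_l2 : l \in @is_l2 R V.
  (* Since [series T 0] is the empty sum, the tail estimate at 0 controls [l] itself. *)
  rewrite (_ : l = (fun v => l v - series T 0%N v) + series T 0%N).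
    rewrite rpredD ?(valP (series T 0%N))//; apply/asboolP.
    by rewrite (le_lt_trans (Dn 0%N))// ltry.
  by apply/funext => v; rewrite [RHS](subrK _ (l v)).
exists (L2 l_l2) => n; apply: sqsum_le_rnorm; first by rewrite subr_ge0.
exact: Dn.
Qed.

Lemma bop_rnormP (V : choiceType) (A : bop (l2 R V)) x :
  l2_rnorm (A x) <= op_rnorm A * l2_rnorm x.
Proof. by have [_ /(_ x)] := op_rnormP A; rewrite !l2_normE -rmorphM lecR. Qed.

(** The series is summed at each vector [x], with an error at most [(s - series e n) * l2_rnorm x].
    As the first factor does not depend on [x], the pointwise limit is linear and bounded, and the
    convergence holds in operator norm. *)
Lemma bop_series_cvg (V : choiceType) (T : nat -> bop (l2 R V)) (e : nat -> R) :
  (forall k, op_rnorm (T k) <= e k) -> cvgn (series e) -> cvgn (series T).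
Proof.
move=> Te ce; set s := limn (series e).
have [E EP] : exists E : l2 R V -> l2 R V, forall x n,
    l2_rnorm (E x - series T n x) <= (s - series e n) * l2_rnorm x.
  suff h x : exists y : l2 R V, forall n,
      l2_rnorm (y - series T n x) <= (s - series e n) * l2_rnorm x.
    by have [E] := choice h; exists E.
  have Tex k : l2_rnorm (T k x) <= e k * l2_rnorm x.
    by rewrite (le_trans (bop_rnormP _ _))// ler_wpM2r// l2_rnorm_ge0.
  have exE : series (fun k => e k * l2_rnorm x) = (fun n => series e n * l2_rnorm x).
    by apply/funext => n; rewrite /series/= mulr_suml.
  have [|y yP] := l2_series_cvg (s := s * l2_rnorm x) Tex.
    by rewrite exE; apply: cvgM => //; exact: cvg_cst.
  exists y => n; have := yP n; rewrite exE -mulrBl.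
  by rewrite -[series T n]/(\sum_(0 <= k < n) T k) bop_sumE.
have s0 : s - series e n @[n --> \oo] --> (0 : R).
  by rewrite -[X in _ --> X](subrr s); apply: cvgB => //; exact: cvg_cst.
have s_ge n : 0 <= s - series e n.
  rewrite subr_ge0; apply: nondecreasing_cvgn_le => // i j ij.
  rewrite -subr_ge0 sub_series_geq// sumr_ge0// => k _.
  exact: le_trans (op_rnorm_ge0 _) (Te k).
have linE : linear E.
  move=> z x y; apply/eqP; rewrite -subr_eq0; apply/eqP.
  apply: l2_rnorm_eq0; apply/eqP; rewrite eq_le l2_rnorm_ge0 andbT.
  set d := (X in l2_rnorm X).
  set C := l2_rnorm (z *: x + y) + (normc z * l2_rnorm x + l2_rnorm y).
  have sC : (s - series e n) * C @[n --> \oo] --> (0 : R).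
    by rewrite -[X in _ --> X](mul0r C); apply: cvgM => //; exact: cvg_cst.
  apply: (cvgr_to_ge sC); apply: nearW => n; set S := series T n.
  (* [d] is the defect of linearity of [E]; since [S] is linear, [d] is a combination of the errors
     [E - S] at three vectors. *)
  have -> : d = (E (z *: x + y) - S (z *: x + y)) +
     ((- z) *: (E x - S x) + (- 1) *: (E y - S y)).
    rewrite bop_linear scaleNr scaleN1r scalerBr !opprB [X in _ = _ + X]addrACA.
    by rewrite -opprD [in RHS]addrA subrK.
  apply: (le_trans (l2_rnormD (E (z *: x + y) - S (z *: x + y)) _)).
  rewrite mulrDr; apply: lerD; first exact: EP.
  apply: (le_trans (l2_rnormD (- z *: (E x - S x)) _)).
  rewrite !l2_rnormZ !normcN ComplexField.Normc.normc1 mul1r mulrDr.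
  apply: lerD; last exact: EP.
  rewrite mulrCA; apply: ler_wpM2l; [exact: normc_nneg|exact: EP].
have e00 : series e 0%N = 0 by rewrite /series/= big_geq.
have bE : E \in @is_bop R (l2 R V).
  (* The bound [s] comes from the error estimate at [n = 0], where the partial sum vanishes. *)
  apply/asboolP; split => //; exists s; split.
    by have := s_ge 0%N; rewrite e00 subr0.
  move=> x; rewrite !l2_normE -rmorphM lecR.
  have := EP x 0%N; rewrite e00 subr0.
  rewrite -[series T 0%N]/(\sum_(0 <= k < 0) T k) big_geq//; apply: le_trans.
  by rewrite [X in _ <= l2_rnorm X]subr0.
apply/cvg_ex; exists (BOp bE).
apply: (cvg_rnorm_le _ s0) => n.
rewrite lecR; apply: op_rnorm_le; split; first exact: s_ge.
move=> x; rewrite !l2_normE -rmorphM lecR; exact: EP.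
Qed.
End l2_operators.

(** * The exponential series and its coefficients for the walk *)

Section exponential.
Variable R : realType.

Lemma normcVn (n : nat) : normc ((n%:R)^-1 : R[i]) = (n%:R)^-1.
Proof.
by apply: (@complexI R); rewrite -normr_complexE normfV normr_nat fmorphV rmorph_nat.
Qed.

Lemma op_rnorm_pow (V : choiceType) (A : bop (l2 R V)) k :
  op_rnorm (bop_pow A k) <= op_rnorm A ^+ k.
Proof.
apply: op_rnorm_le; split; first by rewrite exprn_ge0// op_rnorm_ge0.
move=> x; rewrite !l2_normE -rmorphM lecR.
elim: k => [|k IH]; first by rewrite expr0 mul1r.
rewrite -[bop_pow A k.+1 x]/(A (bop_pow A k x)) (le_trans (bop_rnormP _ _))//.
by rewrite exprS -mulrA ler_wpM2l// op_rnorm_ge0.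
Qed.

Lemma bop_exp_coeff_le (V : choiceType) (A : bop (l2 R V)) k :
  op_rnorm ((k`!%:R)^-1 *: bop_pow A k) <= exp_coeff (op_rnorm A) k.
Proof.
by rewrite op_rnormZ normcVn /exp_coeff /= mulrC ler_wpM2r ?invr_ge0// op_rnorm_pow.
Qed.

(** [limn] is meaningful only for convergent sequences; domination by the real series of
    [exp_coeff (op_rnorm A)] supplies the convergence. *)
Lemma bop_exp_cvg (V : choiceType) (A : bop (l2 R V)) :
  series (fun k => (k`!%:R)^-1 *: bop_pow A k) @ \oo --> bop_exp A.
Proof.
exact: (bop_series_cvg (bop_exp_coeff_le A) (is_cvg_series_exp_coeff _)).
Qed.

Lemma bop_powS (H : normedModType R[i]) (A : bop H) k x :
  bop_pow A k.+1 x = A (bop_pow A k x).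
Proof. by []. Qed.

(** Applying an operator to [f] and reading the value at [v] costs at most a factor [l2_rnorm f], so
    operator-norm convergence passes to entries. *)
Lemma bop_exp_entry (V : choiceType) (A : bop (l2 R V)) f v :
  normc (bop_exp A f v - series (fun k => (k`!%:R)^-1 * bop_pow A k f v) n)
    @[n --> \oo] --> (0 : R).
Proof.
pose S := series (fun k => (k`!%:R)^-1 *: bop_pow A k).
have h : op_rnorm (bop_exp A - S n) @[n --> \oo] --> (0 : R).
  by apply: (cvg_rnorm0 _ (@bop_exp_cvg V A)).
have SE n : S n f v = series (fun k => (k`!%:R)^-1 * bop_pow A k f v) n.
  rewrite -[S n]/(\sum_(0 <= k < n) (k`!%:R)^-1 *: bop_pow A k) bop_sumE.
  rewrite l2_sumE; apply: eq_bigr => k _.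
  by rewrite bop_scaleE l2_scaleE.
apply: (@squeeze_cvgr _ _ _ _ (fun=> 0)
  (fun n => op_rnorm (bop_exp A - S n) * l2_rnorm f)).
- apply: nearW => n; rewrite normc_nneg /= -SE -l2_subE -bop_subE.
  exact: le_trans (l2_rnormP _ _) (bop_rnormP _ _).
- exact: cvg_cst.
- by rewrite -[X in _ --> X](mul0r (l2_rnorm f)); apply: cvgM => //; exact: cvg_cst.
Qed.

(** This is z^k / k! times the number of lattice walks of length k from 0 to v. *)
Definition walk_coeff d (z : R[i]) (k : nat) (v : 'rV[int]_d) : R[i] :=
  (k`!%:R)^-1 * bop_pow (z *: adjacency_op R d) k (delta R 0) v.

Lemma walk_coeff0 d z (v : 'rV[int]_d) : walk_coeff z 0 v = (v == 0)%:R.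
Proof. by rewrite /walk_coeff fact0 invr1 mul1r. Qed.

(** Coefficientwise form of the differential equation of the exponential; the factor k+1 turns
    1/(k+1)! into 1/k!. *)
Lemma walk_coeffS d z k (v : 'rV[int]_d) :
  k.+1%:R * walk_coeff z k.+1 v = z * \sum_s walk_coeff z k (v + unit_step s).
Proof.
rewrite /walk_coeff factS natrM invfM -!mulrA mulVKf ?pnatr_eq0//.
by rewrite bop_powS bop_scaleE l2_scaleE -mulr_sumr mulrCA -[in RHS]adjacencyE.
Qed.

Lemma walk_coeff_le d (z : R[i]) (k : nat) (v : 'rV[int]_d) :
  normc (walk_coeff z k v) <= exp_coeff (op_rnorm (z *: adjacency_op R d)) k.
Proof.
have n1 : l2_rnorm (delta R (0 : 'rV[int]_d)) = 1.
  by rewrite /l2_rnorm sqsum_delta sqrtr1.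
rewrite (le_trans _ (bop_exp_coeff_le _ _))//.
rewrite /walk_coeff -l2_scaleE -bop_scaleE (le_trans (l2_rnormP _ _))//.
by rewrite (le_trans (bop_rnormP _ _))// n1 mulr1.
Qed.

Lemma amplitude_cvg d (v : 'rV[int]_d) (t : R) :
  normc (amplitude v t - series (fun k => walk_coeff (0 +i* t)%C k v) n)
    @[n --> \oo] --> (0 : R).
Proof. rewrite /amplitude l2_inner_delta; exact: bop_exp_entry. Qed.

End exponential.

(** * Cauchy products *)

(** The square of indices k, l < n is cut into the triangle k + l < n, summed by antidiagonals, and
    the remainder k + l >= n. *)
Lemma cauchy_product_gap (K : pzSemiRingType) (a b : nat -> K) n :
  (\sum_(0 <= k < n) a k) * (\sum_(0 <= l < n) b l) =
  \sum_(0 <= m < n) \sum_(l < m.+1) a l * b (m - l)%N +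
  \sum_(0 <= k < n) \sum_(n - k <= l < n) a k * b l.
Proof.
have tri : \sum_(0 <= m < n) \sum_(l < m.+1) a l * b (m - l)%N =
    \sum_(0 <= k < n) \sum_(0 <= l < n - k) a k * b l.
  elim: n => [|n IH]; first by rewrite !big_nil.
  rewrite big_nat_recr//= IH -(big_mkord xpredT (fun l => a l * b (n - l)%N)).
  (* The added row k = n is empty; then each row gains exactly its entry on the antidiagonal k + l =
     n. *)
  have -> : \sum_(0 <= k < n) \sum_(0 <= l < n - k) a k * b l =
      \sum_(0 <= k < n.+1) \sum_(0 <= l < n - k) a k * b l.
    by rewrite [RHS]big_nat_recr//= subnn [X in _ + X]big_nil addr0.
  rewrite -big_split/=; apply: eq_big_nat => k /andP[_ kn].
  by rewrite subSn// big_nat_recr.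
rewrite tri -big_split/= mulr_suml; apply: eq_bigr => k _.
by rewrite mulr_sumr -big_cat_nat//= leq_subr.
Qed.

(** The binomial theorem divided by m!. *)
Lemma exp_coeff_conv (R : realType) (x y : R) m :
  \sum_(l < m.+1) exp_coeff x l * exp_coeff y (m - l)%N = exp_coeff (x + y) m.
Proof.
rewrite /exp_coeff /= addrC exprDn mulr_suml; apply: eq_bigr => l _.
have lm : (l <= m)%N by rewrite -ltnS.
rewrite -(bin_fact lm) !natrM -mulr_natr.
have := fact_gt0 l; have := fact_gt0 (m - l); have := lm; rewrite -bin_gt0.
rewrite -3!(ltr0n R) => /lt0r_neq0 ? /lt0r_neq0 ? /lt0r_neq0 ?.
by field; do ?[apply/andP; split].
Qed.

Section cauchy_product.
Variable R : realType.

Lemma normc_sum_le (I : Type) (r : seq I) (F : I -> R[i]) (e : I -> R) :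
  (forall k, normc (F k) <= e k) ->
  normc (\sum_(k <- r) F k) <= \sum_(k <- r) e k.
Proof.
move=> Fe; elim/big_ind2 : _ => //; first by rewrite ComplexField.Normc.normc0.
by move=> x1 x2 y1 y2 h1 h2; rewrite (le_trans (le_normcD _ _))// lerD.
Qed.

Lemma cauchy_product_cvg (a b : nat -> R[i]) (la lb : R[i]) (x y : R) :
  (forall k, normc (a k) <= exp_coeff x k) ->
  (forall k, normc (b k) <= exp_coeff y k) ->
  normc (la - series a n) @[n --> \oo] --> (0 : R) ->
  normc (lb - series b n) @[n --> \oo] --> (0 : R) ->
  normc (la * lb -
    series (fun m => \sum_(l < m.+1) a l * b (m - l)%N) n) @[n --> \oo] --> (0 : R).
Proof.
move=> ax by_ ca cb.
pose gap n := \sum_(0 <= k < n) \sum_(n - k <= l < n) exp_coeff x k * exp_coeff y l.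
have gap0 : gap n @[n --> \oo] --> (0 : R).
  have -> : gap = (fun n => series (exp_coeff x) n * series (exp_coeff y) n -
      series (exp_coeff (x + y)) n).
    apply/funext => n; rewrite [X in X - _]cauchy_product_gap.
    under eq_bigr do rewrite exp_coeff_conv.
    by rewrite addrAC subrr add0r.
  rewrite -(subrr (expR x * expR y)) -{2}expRD.
  apply: cvgB; last exact: is_cvg_series_exp_coeff.
  by apply: cvgM; exact: is_cvg_series_exp_coeff.
pose alpha n := normc (la - series a n); pose beta n := normc (lb - series b n).
(* The first three terms bound the difference between [la * lb] and the product of partial sums;
   [gap] bounds the product minus the Cauchy partial sum. *)
pose bound n := alpha n * normc lb + normc la * beta n + alpha n * beta n + gap n.
have bound0 : bound n @[n --> \oo] --> (0 : R).
  have -> : (0 : R) = 0 * normc lb + normc la * 0 + 0 * 0 + 0 by ring.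
  apply: cvgD => //; apply: cvgD; last exact: cvgM.
  by apply: cvgD; apply: cvgM => //; exact: cvg_cst.
apply: (squeeze_cvgr _ (cvg_cst 0) bound0); apply: nearW => n.
rewrite normc_nneg /=.
pose g := \sum_(0 <= k < n) \sum_(n - k <= l < n) a k * b l.
have -> : la * lb - series (fun m => \sum_(l < m.+1) a l * b (m - l)%N) n =
    (la - series a n) * lb + la * (lb - series b n) +
    - ((la - series a n) * (lb - series b n)) + g.
  have AB : series a n * series b n =
      series (fun m => \sum_(l < m.+1) a l * b (m - l)%N) n + g.
    exact: cauchy_product_gap.
  rewrite -[series (fun m => _) n](addrK g) -AB; ring.
rewrite (le_trans (le_normcD _ _))// lerD//.
  rewrite (le_trans (le_normcD _ _))// lerD//.
    by rewrite (le_trans (le_normcD _ _))// lerD// ComplexField.Normc.normcM.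
  by rewrite normcN ComplexField.Normc.normcM.
apply: normc_sum_le => k; apply: normc_sum_le => l.
by rewrite ComplexField.Normc.normcM ler_pM ?normc_nneg.
Qed.
End cauchy_product.

(** * From the plane to the line: the convolution identity *)

Lemma sum_unit_step1 (K : nmodType) (f : 'rV[int]_1 -> K) i :
  \sum_s f (point1 i + unit_step s) = \sum_(b : bool) f (point1 (i + (-1) ^+ b)).
Proof.
rewrite -(pair_bigA _ (fun k b => f (point1 i + unit_step (k, b)))) big_ord1.
apply: eq_bigr => b _; congr f; apply/rowP => k.
by rewrite mxE unit_stepE !mxE (ord1 k) mulr1.
Qed.

(** Each neighbour changes a single coordinate, which is how the adjacency operator of Z^2 splits
    into two copies of that of Z. *)
Lemma sum_unit_step2 (K : nmodType) (f : 'rV[int]_2 -> K) i j :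
  \sum_s f (point2 i j + unit_step s) =
  \sum_(b : bool) f (point2 (i + (-1) ^+ b) j) +
  \sum_(b : bool) f (point2 i (j + (-1) ^+ b)).
Proof.
rewrite -(pair_bigA _ (fun k b => f (point2 i j + unit_step (k, b)))).
rewrite big_ord_recl big_ord1; congr (_ + _); apply: eq_bigr => b _; congr f;
  apply/rowP => k; rewrite mxE unit_stepE !mxE;
  by case: (unliftP ord0 k) => [k'|] ->; rewrite ?(ord1 k')/= ?mulr1 ?mulr0 ?addr0.
Qed.

Section walks.
Variable R : realType.

Lemma walk_coeff2 (z : R[i]) k i j : walk_coeff z k (point2 i j) =
  \sum_(l < k.+1) walk_coeff z l (point1 i) * walk_coeff z (k - l)%N (point1 j).
Proof.
elim: k i j => [|k IH] i j.
  (* At k = 0 the claim is that the indicator of the origin factors over the coordinates. *)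
  rewrite big_ord1 !walk_coeff0 -natrM mulnb; congr ((nat_of_bool _)%:R).
  apply/eqP/andP => [e|[/eqP ei /eqP ej]].
    have ei := congr1 (fun u : 'rV_2 => u 0 0) e.
    have ej := congr1 (fun u : 'rV_2 => u 0 1) e.
    by move: ei ej; rewrite !mxE /= => -> ->; split; apply/eqP/rowP => u; rewrite !mxE.
  have := congr1 (fun u : 'rV_1 => u 0 0) ei.
  have := congr1 (fun u : 'rV_1 => u 0 0) ej.
  rewrite !mxE => -> ->; apply/rowP => u; rewrite !mxE.
  by case: (unliftP ord0 u) => [u'|] ->; rewrite ?(ord1 u').
have kn0 : k.+1%:R != 0 :> R[i] by rewrite pnatr_eq0.
apply: (mulfI kn0); rewrite walk_coeffS sum_unit_step2.
under eq_bigr do rewrite IH; under [X in _ + X]eq_bigr do rewrite IH.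
set a := fun l => walk_coeff z l (point1 i); set b := fun l => walk_coeff z l (point1 j).
(* Leibniz rule: writing k+1 = l + (k+1-l) lets the recurrence act on one factor at a time. *)
have -> : k.+1%:R * (\sum_(l < k.+2) a l * b (k.+1 - l)%N) =
   \sum_(l < k.+2) (l%:R * a l) * b (k.+1 - l)%N +
   \sum_(l < k.+2) a l * ((k.+1 - l)%:R * b (k.+1 - l)%N).
  rewrite mulr_sumr -big_split; apply: eq_bigr => l _ /=.
  have lk : (l <= k.+1)%N by rewrite -ltnS.
  have -> : k.+1%:R = l%:R + (k.+1 - l)%:R :> R[i] by rewrite -natrD subnKC.
  by rewrite mulrDl -mulrA [a l * (_ * _)]mulrCA.
(* The term l = 0 of the first sum and l = k+1 of the second carry a zero factor; what is left has
   the range of the induction hypothesis. *)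
rewrite [X in _ = X + _]big_ord_recl [X in _ = _ + X]big_ord_recr /=.
rewrite subnn !mul0r mulr0 addr0 add0r.
rewrite mulrDr; congr (_ + _).
  rewrite exchange_big mulr_sumr; apply: eq_bigr => l _ /=.
  by rewrite subSS -mulr_suml mulrA walk_coeffS sum_unit_step1.
rewrite exchange_big mulr_sumr; apply: eq_bigr => l _ /=.
rewrite subSn -1?ltnS// -mulr_sumr mulrCA; congr (_ * _).
by rewrite walk_coeffS sum_unit_step1.
Qed.

End walks.

Theorem theorem1p4 (R : realType) (i j : int) (t : R) :
  amplitude (point2 i j) t = amplitude (point1 i) t * amplitude (point1 j) t.
Proof.
(* Both sides are limits of the same partial sums, once the planar coefficients are rewritten as
   convolutions. *)
apply: (normc_lim_unique (amplitude_cvg (point2 i j) t)).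
rewrite (funext (fun k => walk_coeff2 (0 +i* t)%C k i j)).
exact: (cauchy_product_cvg (fun k => walk_coeff_le _ k _)
  (fun k => walk_coeff_le _ k _) (amplitude_cvg (point1 i) t)
  (amplitude_cvg (point1 j) t)).
Qed.
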